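(* Let $R$ be a one-dimensional, local, reduced Noetherian ring with infinite residue field and total ring of fractions $Q(R)$, and assume that the integral closure $\overline R$ of $R$ in $Q(R)$ is a finitely generated $R$-module. Let $C=(R:_{Q(R)}\overline R)$ be the conductor. Let $I$ be a regular ideal of $R$ with principal reduction $x$ and reduction number $r=r(I)$, and set $$l=\min\{m\in\mathbb N \mid I^rx^{-r+m}\subseteq C\}.$$ If $l<r$, then $h(I)=r$.
   Context: An ideal is regular if it contains a non-zero-divisor. A principal reduction of $I$ is an element $x\in I$ with $I^{n+1}=xI^n$ for some $n\ge0$; since $I$ is regular, $x$ is a non-zero-divisor, so it is invertible in $Q(R)$, and $I^rx^{-r+m}$ denotes the $R$-submodule $\{x^{-r+m}y\mid y\in I^r\}$ of $Q(R)$. The reduction number is $r(I)=\min\{n\in\mathbb N\mid I^{n+1}=xI^n\}$, which is independent of the principal reduction $x$. Here $\mathbb N$ contains $0$ and $\mathbb N_+$ is the set of positive integers. The conductor is $C=\{q\in Q(R)\mid q\overline R\subseteq R\}$. For a regular ideal $L$ of $R$, the Ratliff-Rush closure is $\widetilde L=\bigcup_{n\ge1}(L^{n+1}:_RL^n)$, and $h(I)=\min\{n\in\mathbb N_+\mid I^m=\widetilde{I^m}\ \text{for all } m\ge n\}$. *)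

(* Defs.v *)
From HB Require Import structures.
From mathcomp Require Import all_boot all_order all_algebra.
From mathcomp Require Import all_classical.
Set Implicit Arguments.
Unset Strict Implicit.
Unset Printing Implicit Defensive.
Import Order.TTheory GRing.Theory.
Local Open Scope classical_set_scope.
Local Open Scope ring_scope.

Definition is_min (P : set nat) (n : nat) : Prop :=
  P n /\ forall k, P k -> (n <= k)%N.

Section Ideals.
Variable R : comNzRingType.
Implicit Types (I J L P : set R) (a x : R) (n : nat).

(* The library's [idealr_closed] only covers boolean predicates and proper
   ideals; here the unit ideal [setT] is an ideal. *)
Definition is_ideal I : Prop :=
  [/\ I 0, forall a b, I a -> I b -> I (a + b)
    & forall a b, I b -> I (a * b)].

Definition ideal_gen (S : set R) : set R := smallest is_ideal S.

Definition ideal_mul I J : set R :=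
  ideal_gen [set z | exists2 a, I a & exists2 b, J b & z = a * b].

(* I^0 is the unit ideal. *)
Definition ideal_exp I n : set R := iter n (ideal_mul I) setT.

Definition ideal_colon I J : set R := [set a | forall b, J b -> I (a * b)].

Definition scale_ideal x I : set R := [set x * y | y in I].

(* In a commutative ring, [GRing.lreg a] says that a is a non-zero-divisor. *)
Definition regular_ideal I : Prop :=
  is_ideal I /\ exists2 a, I a & GRing.lreg a.

Definition prime_ideal P : Prop :=
  [/\ is_ideal P, ~ P 1 & forall a b, P (a * b) -> P a \/ P b].

Definition maximal_ideal (m : set R) : Prop :=
  [/\ is_ideal m, ~ m 1
    & forall J, is_ideal J -> m `<=` J -> ~ J 1 -> J = m].

Definition principal_reduction I x : Prop :=
  I x /\ exists n, ideal_exp I n.+1 = scale_ideal x (ideal_exp I n).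

Definition is_reduction_number I x : nat -> Prop :=
  is_min [set n | ideal_exp I n.+1 = scale_ideal x (ideal_exp I n)].

Definition ratliff_rush L : set R :=
  \bigcup_(n in [set n | (1 <= n)%N])
    ideal_colon (ideal_exp L n.+1) (ideal_exp L n).

Definition is_h I : nat -> Prop :=
  is_min [set n | (0 < n)%N /\ forall m, (n <= m)%N ->
                   ideal_exp I m = ratliff_rush (ideal_exp I m)].

End Ideals.

Section RingProperties.
Variable R : comNzRingType.

Definition noetherian_ring : Prop :=
  forall I : set R, is_ideal I -> exists s : seq R, I = ideal_gen [set` s].

Definition reduced_ring : Prop :=
  forall (a : R) (n : nat), a ^+ n = 0 -> a = 0.

Definition local_ring : Prop := exists! m : set R, maximal_ideal m.

(* The residue field R/m, as the set of cosets a + m. *)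
Definition residue_field (m : set R) : set (set R) :=
  range (fun a : R => [set b | m (b - a)]).

Definition infinite_residue_field : Prop :=
  forall m : set R, maximal_ideal m -> infinite_set (residue_field m).

Definition prime_chain (n : nat) (P : nat -> set R) : Prop :=
  (forall i, (i <= n)%N -> prime_ideal (P i)) /\
  (forall i, (i < n)%N -> P i `<` P i.+1).

Definition has_krull_dim (n : nat) : Prop :=
  (exists P, prime_chain n P) /\ ~ (exists P, prime_chain n.+1 P).

End RingProperties.

Section TotalFractions.
Variables (R : comNzRingType) (Q : comUnitRingType).
Variable iota : {rmorphism R -> Q}.

(* Q, with R embedded by iota, is the localization of R at the set of its
   non-zero-divisors; this determines Q up to a unique R-isomorphism. *)
Definition total_ring_of_fractions : Prop :=
  [/\ injective iota,
      forall b, GRing.lreg b -> iota b \is a GRing.unit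
    & forall q, exists a b, GRing.lreg b /\ q = iota a / iota b].

Definition is_submodule (M : set Q) : Prop :=
  [/\ M 0, forall p q, M p -> M q -> M (p + q)
    & forall a q, M q -> M (iota a * q)].

Definition fin_gen_submodule (M : set Q) : Prop :=
  exists s : seq Q, M = smallest is_submodule [set` s].

Definition integral_closure : set Q := [set q | integralOver iota q].

Definition conductor : set Q :=
  [set q | forall y, integral_closure y -> range iota (q * y)].

(* x^k J inside Q, for an integer exponent k. *)
Definition scaled_submodule (x : R) (k : int) (J : set R) : set Q :=
  [set iota x ^ k * iota y | y in J].

End TotalFractions.

(* Main.v *)
(** In terms of the blow-up [B = I^r x^-r], one has [I^m = x^m B] for [m >= r]
    and the Ratliff-Rush closure of [I^m] is [x^m B `&` R] for every [m > 0], so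
    [I^m] is closed for [m >= r]. If [l < r], then [x^(r-1) B] is contained in
    the conductor, hence in [R], so the closure of [I^(r-1)] is [x^(r-1) B]. If
    [I^(r-1)] were closed, then [I^r = x^r B = x I^(r-1)], against the
    minimality of [r]. *)

Require Import Defs.
From HB Require Import structures.
From mathcomp Require Import all_boot all_order all_algebra.
From mathcomp Require Import all_classical.
From mathcomp Require Import zify.
Set Implicit Arguments.
Unset Strict Implicit.
Unset Printing Implicit Defensive.
Import Order.TTheory GRing.Theory.
Local Open Scope classical_set_scope.
Local Open Scope ring_scope.

Section IdealPowers.
Variable R : comNzRingType.
Implicit Types (I J K : set R) (a b x y : R) (m n r : nat).

Lemma ideal_gen_is_ideal (S : set R) : is_ideal (ideal_gen S).
Proof.
split.
- by move=> J [[J0 _ _] _].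
- by move=> a b Sa Sb J JS; have [[_ JD _] _] := JS; apply: JD; [exact: (Sa J)|exact: (Sb J)].
- by move=> a b Sb J JS; have [[_ _ JM] _] := JS; apply: JM; exact: (Sb J).
Qed.

Lemma ideal_exp_is_ideal I n : is_ideal (ideal_exp I n).
Proof. by case: n => [|n]; [split|exact: ideal_gen_is_ideal]. Qed.

Lemma mem_ideal_mul I J a b : I a -> J b -> ideal_mul I J (a * b).
Proof. by move=> Ia Jb L [_]; apply; exists a => //; exists b. Qed.

Lemma ideal_mul_sub I J K : is_ideal K ->
  (forall a b, I a -> J b -> K (a * b)) -> ideal_mul I J `<=` K.
Proof.
move=> idK IJK; apply: smallest_sub => // _ [a Ia [b Jb ->]].
exact: IJK.
Qed.

Lemma ideal_mulC I J : ideal_mul I J = ideal_mul J I.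
Proof.
by rewrite eqEsubset; split; apply: ideal_mul_sub => [|a b ha hb];
  [exact: ideal_gen_is_ideal | rewrite mulrC; exact: mem_ideal_mul
  |exact: ideal_gen_is_ideal | rewrite mulrC; exact: mem_ideal_mul].
Qed.

(** With one factor [a] fixed, this reduces a claim about [a * z], for [z] in a product ideal, to
    the generators of that ideal. *)
Lemma is_ideal_preim_mul K a : is_ideal K -> is_ideal [set z | K (a * z)].
Proof.
case=> K0 KD KM; split => /= [|u v|u v]; first by rewrite mulr0.
- by rewrite mulrDr; exact: KD.
- by rewrite mulrCA; exact: KM.
Qed.

Lemma scale_ideal_is_ideal x K : is_ideal K -> is_ideal (scale_ideal x K).
Proof.
case=> K0 KD KM; split; first by exists 0; rewrite ?mulr0.
- by move=> _ _ [u Ku <-] [v Kv <-]; exists (u + v); [exact: KD|rewrite mulrDr].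
- by move=> a _ [u Ku <-]; exists (a * u); [exact: KM|rewrite mulrCA].
Qed.

Lemma ideal_mulA I J K :
  ideal_mul I (ideal_mul J K) = ideal_mul (ideal_mul I J) K.
Proof.
have sub (A B C : set R) : ideal_mul A (ideal_mul B C) `<=` ideal_mul (ideal_mul A B) C.
  apply: ideal_mul_sub => [|a z Aa BCz]; first exact: ideal_gen_is_ideal.
  have idK := is_ideal_preim_mul a (ideal_gen_is_ideal _).
  apply: (ideal_mul_sub (idK _)) BCz.
  move=> b c Bb Cc /=; rewrite mulrA; apply: mem_ideal_mul => //.
  exact: mem_ideal_mul.
rewrite eqEsubset; split; first exact: sub.
(* By commutativity, the reverse inclusion is [sub] applied to [K], [J], [I]. *)
by rewrite ideal_mulC (ideal_mulC I J) (ideal_mulC I) (ideal_mulC J K).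
Qed.

Lemma ideal_mulTr J : is_ideal J -> ideal_mul setT J = J.
Proof.
move=> idJ; rewrite eqEsubset; split => [|y Jy].
- by apply: ideal_mul_sub => // a b _; case: idJ => _ _; apply.
- by rewrite -[y]mul1r; exact: mem_ideal_mul.
Qed.

Lemma ideal_expD I m n :
  ideal_exp I (m + n) = ideal_mul (ideal_exp I m) (ideal_exp I n).
Proof.
elim: m => [|m IHm]; first by rewrite ideal_mulTr //; exact: ideal_exp_is_ideal.
by rewrite addSn /= -/(ideal_exp _ _) IHm ideal_mulA.
Qed.

Lemma ideal_expM I m n : ideal_exp (ideal_exp I m) n = ideal_exp I (m * n).
Proof.
elim: n => [|n IHn]; first by rewrite muln0.
by rewrite mulnS ideal_expD -IHn.
Qed.

Lemma mem_ideal_exp I a n : I a -> ideal_exp I n (a ^+ n).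
Proof.
by move=> Ia; elim: n => // n IHn; rewrite exprS; exact: mem_ideal_mul.
Qed.

(** If [a] in [I] is a non-zero-divisor, then [a ^+ n.+1] lies in I^(n+1) = x I^n, so [x] divides a
    non-zero-divisor. *)
Lemma principal_reduction_lreg I x :
  regular_ideal I -> principal_reduction I x -> GRing.lreg x.
Proof.
move=> [_ [a Ia areg]] [_ [n redn]].
have : ideal_exp I n.+1 (a ^+ n.+1) by exact: mem_ideal_exp.
rewrite redn => -[y _ xy]; apply: (@GRing.lregMl _ y).
by rewrite mulrC xy; exact: lregX.
Qed.

(** Multiply I^(r+1) = x I^r by I^(m-r) and pull [x] out of each generator. *)
Lemma reduction_sub I x r m : (r <= m)%N ->
  ideal_exp I r.+1 = scale_ideal x (ideal_exp I r) ->
  ideal_exp I m.+1 `<=` scale_ideal x (ideal_exp I m).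
Proof.
move=> /subnK <- red; rewrite -addnS ideal_expD red.
rewrite ideal_expD; apply: ideal_mul_sub => [|a _ Ia [y Iy <-]].
  exact/scale_ideal_is_ideal/ideal_gen_is_ideal.
by exists (a * y); [exact: mem_ideal_mul|rewrite mulrCA].
Qed.

Lemma reduction_expr_sub I x r m n : (r <= m)%N ->
  ideal_exp I r.+1 = scale_ideal x (ideal_exp I r) ->
  ideal_exp I (n + m) `<=` scale_ideal (x ^+ n) (ideal_exp I m).
Proof.
move=> rm red; elim: n => [|n IHn] y; first by exists y; rewrite ?expr0 ?mul1r.
rewrite addSn => /(reduction_sub (leq_trans rm (leq_addl n m)) red).
by move=> [_ /IHn [w Iw <-] <-]; exists w; rewrite // exprS mulrA.
Qed.

Lemma sub_ratliff_rush I : I `<=` ratliff_rush I.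
Proof. by move=> a Ia; exists 1 => // b; exact: mem_ideal_mul. Qed.

(** If [a] multiplies I^(mn) into I^(mn+m), test it on x^(mn): the product lies in I^(mn+m), hence
    in x^(mn) I^m, and x^(mn) cancels. *)
Lemma ratliff_rush_exp I x r m : I x -> GRing.lreg x -> (r <= m)%N ->
  ideal_exp I r.+1 = scale_ideal x (ideal_exp I r) ->
  ratliff_rush (ideal_exp I m) = ideal_exp I m.
Proof.
move=> Ix xreg rm red; rewrite eqEsubset; split; last exact: sub_ratliff_rush.
move=> a [n _]; rewrite !ideal_expM mulnS addnC => /(_ (x ^+ (m * n))).
move=> /(_ (mem_ideal_exp _ Ix)) /(reduction_expr_sub rm red) [y Iy].
by rewrite [a * _]mulrC => /(lregX xreg) <-.
Qed.

(** For [b] in I^(sr), the product x z b lies in I^(s+1+sr). Since s + sr >= r, this ideal is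
    contained in x I^(s+sr), and cancelling [x] leaves z b in I^(s(r+1)). Thus [r] serves as the
    index in the union defining the closure. *)
Lemma mem_ratliff_rush_div I x r s z : GRing.lreg x -> (0 < r)%N -> (0 < s)%N ->
  ideal_exp I r.+1 = scale_ideal x (ideal_exp I r) ->
  ideal_exp I s.+1 (x * z) -> ratliff_rush (ideal_exp I s) z.
Proof.
move=> xreg r0 s0 red Ixz; exists r => // b; rewrite !ideal_expM => Ib.
have : ideal_exp I (s.+1 + s * r) (x * z * b).
  by rewrite ideal_expD; exact: mem_ideal_mul.
rewrite addSn -mulnS => /(reduction_sub _ red) [].
  by rewrite mulnS (leq_trans _ (leq_addl _ _)) // leq_pmull.
by move=> w Iw; rewrite -mulrA => /xreg <-.
Qed.

End IdealPowers.

Lemma conductor_sub_range (R : comNzRingType) (Q : comUnitRingType)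
  (iota : {rmorphism R -> Q}) : conductor iota `<=` range iota.
Proof.
by move=> q /(_ 1 (integral1 iota)); rewrite mulr1.
Qed.

Theorem proposition4p4
  (R : comNzRingType) (Q : comUnitRingType) (iota : {rmorphism R -> Q})
  (R_noetherian : noetherian_ring R)
  (R_local : local_ring R)
  (R_reduced : reduced_ring R)
  (R_dim1 : has_krull_dim R 1)
  (R_residue : infinite_residue_field R)
  (Q_total : total_ring_of_fractions iota)
  (Rbar_fin : fin_gen_submodule iota (integral_closure iota))
  (I : set R) (I_regular : regular_ideal I)
  (x : R) (x_red : principal_reduction I x)
  (r : nat) (r_red : is_reduction_number I x r)
  (l : nat)
  (l_min : is_min [set m : nat |
             scaled_submodule iota x (- r%:Z + m%:Z) (ideal_exp I r)
               `<=` conductor iota] l)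
  (l_lt_r : (l < r)%N) :
  is_h I r.
Proof.
have [Ix _] := x_red; have [red rmin] := r_red.
have xreg := principal_reduction_lreg I_regular x_red.
have [iota_inj iota_unit _] := Q_total.
have ux := iota_unit _ xreg.
have r0 : (0 < r)%N by exact: leq_ltn_trans l_lt_r.
split=> [|k [k0 closed]].
  by split=> // m rm; rewrite (ratliff_rush_exp Ix xreg rm red).
rewrite leqNgt; apply/negP => k_lt_r.
(* From 0 < k < r, the exponent r - 1 is positive and lies in the range where [closed] applies. *)
have s0 : (0 < r.-1)%N by rewrite -ltnS prednK // (leq_ltn_trans k0).
have k_le : (k <= r.-1)%N by rewrite -ltnS prednK.
suff /rmin : ideal_exp I r.-1.+1 = scale_ideal x (ideal_exp I r.-1).
  by rewrite leqNgt prednK // leqnn.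
rewrite eqEsubset; split=> [y|_ [z Iz <-]]; last exact: mem_ideal_mul.
rewrite prednK // => Iy.
(* The choice of [l] puts x^(l-r) y in the conductor, hence in the image of [R]. *)
have [z xz] : exists z, iota z = iota x ^ (- r%:Z + l%:Z) * iota y.
  have [/(_ (iota x ^ (- r%:Z + l%:Z) * iota y)) yC _] := l_min.
  have /yC/conductor_sub_range [z _ <-] : scaled_submodule iota x
    (- r%:Z + l%:Z) (ideal_exp I r) (iota x ^ (- r%:Z + l%:Z) * iota y).
    by exists y.
  by exists z.
(* Since l <= r - 1, the quotient y / x = x^(r-1-l) (x^(l-r) y) is in [R]. After applying [iota],
   the exponents of [x] add up to 0. *)
have yE : y = x * (x ^+ (r.-1 - l) * z).
  apply: iota_inj; rewrite mulrA -exprS rmorphM rmorphXn xz mulrA.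
  rewrite exprnP -exprzDr // -[LHS]mul1r -(expr0z (iota x)).
  by congr (_ ^ _ * _); lia.
exists (x ^+ (r.-1 - l) * z); last by rewrite -yE.
(* The quotient y / x is in the closure of I^(r-1) because [y] is in I^r; closedness then puts it in
   I^(r-1) itself. *)
rewrite closed //; apply: (mem_ratliff_rush_div xreg r0 s0 red).
by rewrite prednK // -yE.
Qed.
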